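(* Let $R$ be any given four-sided convex polygon in the $xy$ plane. Then there is a unique ellipse of maximal area inscribed in $R$. There is no ellipse of minimal area inscribed in $R$.
   Context: An ellipse is said to be inscribed in a four-sided convex polygon $R$ if the ellipse lies inside $R$ (regarded as a region of the plane) and is tangent to each of the four sides of $R$. Ellipses are non-degenerate, and circles count as ellipses. ''Maximal area'' (respectively ''minimal area'') means that the area is largest (respectively smallest) among all ellipses inscribed in $R$. *)

(* Defs.v *)
From HB Require Import structures.
From mathcomp Require Import all_boot all_order all_algebra.
From mathcomp Require Import all_classical all_reals all_analysis.

Set Implicit Arguments.
Unset Strict Implicit.
Unset Printing Implicit Defensive.

Import Order.TTheory GRing.Theory Num.Theory.
Import numFieldNormedType.Exports.

Local Open Scope classical_set_scope.
Local Open Scope ring_scope.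

(* Twice the signed area of the triangle a b c. *)
Definition orient (R : realType) (a b c : R * R) : R :=
  (b.1 - a.1) * (c.2 - a.2) - (b.2 - a.2) * (c.1 - a.1).

(* A four-sided polygon is given by its vertices V 0, ..., V 3 in cyclic order
   (either orientation); addition on 'I_4 is modulo 4, so the sides join V i
   to V (i + 1). It is convex, and genuinely four-sided, when for each side the
   two other vertices lie strictly on the same side of the line through it. *)
Definition convex_quadrilateral (R : realType) (V : 'I_4 -> R * R) : Prop :=
  forall i : 'I_4,
    0 < orient (V i) (V (i + 1)) (V (i + 2)) *
        orient (V i) (V (i + 1)) (V (i + 3)).

Definition region (R : realType) (V : 'I_4 -> R * R) : set (R * R) :=
  [set p | exists w : 'I_4 -> R,
    [/\ forall i, 0 <= w i, \sum_i w i = 1 & p = \sum_i w i *: V i]].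

Definition side (R : realType) (V : 'I_4 -> R * R) (i : 'I_4) : set (R * R) :=
  [set (1 - t) *: V i + t *: V (i + 1) | t in `[0, 1]].

(* The axis of half-length semi1 makes the angle tilt with the x-axis. The same
   ellipse has several descriptions of this kind, so that ellipses have to be
   compared through the sets ellipse_curve. *)
Record ellipse (R : realType) := Ellipse {
  center : R * R;
  semi1 : R;
  semi2 : R;
  tilt : R;
  semi1_gt0 : 0 < semi1;
  semi2_gt0 : 0 < semi2
}.

Definition ellipse_form (R : realType) (e : ellipse R) (p : R * R) : R :=
  let x := p.1 - (center e).1 in
  let y := p.2 - (center e).2 in
  ((x * cos (tilt e) + y * sin (tilt e)) / semi1 e) ^+ 2 +
  ((y * cos (tilt e) - x * sin (tilt e)) / semi2 e) ^+ 2.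

Definition ellipse_curve (R : realType) (e : ellipse R) : set (R * R) :=
  [set p | ellipse_form e p = 1].

Definition ellipse_disk (R : realType) (e : ellipse R) : set (R * R) :=
  [set p | ellipse_form e p <= 1].

Definition area (R : realType) (e : ellipse R) : \bar R :=
  (@lebesgue_measure R \x @lebesgue_measure R)%E (ellipse_disk e).

(* The gradient of ellipse_form e does not vanish on the curve, so the tangent
   line at a point p of the curve has direction v exactly when the derivative
   of ellipse_form e at p along v <> 0 is zero. *)
Definition tangent_to_side (R : realType) (V : 'I_4 -> R * R) (e : ellipse R)
    (i : 'I_4) : Prop :=
  exists p : R * R,
    [/\ ellipse_curve e p, side V i p
      & 'D_(V (i + 1) - V i) (ellipse_form e) p = 0].

Definition inscribed (R : realType) (V : 'I_4 -> R * R) (e : ellipse R) : Prop :=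
  ellipse_curve e `<=` region V /\ forall i : 'I_4, tangent_to_side V e i.

Definition maximal_area_inscribed (R : realType) (V : 'I_4 -> R * R)
    (e : ellipse R) : Prop :=
  inscribed V e /\ forall e', inscribed V e' -> (area e' <= area e)%E.

Definition minimal_area_inscribed (R : realType) (V : 'I_4 -> R * R)
    (e : ellipse R) : Prop :=
  inscribed V e /\ forall e', inscribed V e' -> (area e <= area e')%E.

(* Main.v *)
Require Import Defs.
From mathcomp Require Import all_boot all_order all_algebra.
From mathcomp Require Import all_classical all_reals all_analysis.
From mathcomp Require Import measurable_realfun.
From mathcomp Require Import ring lra.

(** An ellipse is determined by its center [m] and a positive definite symmetric
    matrix [S]: it is the curve [(z - m)^T S^-1 (z - m) = 1], in any affine
    coordinates.  This dual description is the right one for tangency: the line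
    [n . z = h] touches the ellipse exactly when [(h - n . m)^2 = n^T S n], which
    is an affine equation in the pair [(m, S - m m^T)].  Four sides give four
    affine equations in five unknowns, so that the conics tangent to the four
    side lines form an affine line.

    The computation is transparent when the two diagonals are the coordinate
    axes.  The vertices are then [(a, 0)], [(0, b)], [(c, 0)], [(0, d)] with
    [a < 0 < c] and [b < 0 < d], and the solutions are, for a parameter [k],
    [m = (k (a + c) / 2, (1 - k) (b + d) / 2)] and
    [S = m m^T + diag (- k a c, - (1 - k) b d)] ([touches_newton_conic]): the
    centers run along the line through the midpoints of the diagonals, as Newton
    found.  The points of contact lie on the sides, and not merely on the lines
    that carry them, exactly for [0 < k < 1] ([tangent_newton_range] and
    [newton_inscribed]).  The inscribed ellipses are thus parametrized by the
    open unit interval.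

    Up to a constant factor the square of the area is [det S], which is the cubic
    [k (1 - k) ((1 - k) p + k r)] with [p] and [r] positive ([det_newton]).  It
    is positive inside the interval and zero at both ends, so that it has a
    maximum and its infimum [0] is not attained.  It is a product of three
    positive affine functions of [k], two of them not constant, so that its
    logarithm is strictly concave and the maximum is attained only once
    ([cubic_midpoint]).

    The area is linked to [det S] by slicing: the sections of the elliptic disk
    are intervals whose lengths are, up to an affine change of variable, those of
    the sections of the unit disk ([area_semi_axes]). *)

Set Implicit Arguments.
Unset Strict Implicit.
Unset Printing Implicit Defensive.

Import Order.TTheory GRing.Theory Num.Theory.
Import numFieldNormedType.Exports.

Local Open Scope classical_set_scope.
Local Open Scope ring_scope.

(** * Ellipses given by a center and a dual matrix *)

Section Conics.
Context (R : realType).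
Implicit Types (e : ellipse R) (z o u v d : R * R).

Definition cross u v : R := u.1 * v.2 - u.2 * v.1.

Definition frame o u v z : R * R := o + z.1 *: u + z.2 *: v.

(** The symmetric matrix [S = [sxx sxy; sxy syy]] is the inverse of the
    matrix of the quadratic form: with [S] rather than its inverse, tangency to
    a line is an affine condition and the squared area is, up to a factor, a
    polynomial. *)
Record conic := Conic { conic_center : R * R; sxx : R; sxy : R; syy : R }.
Implicit Type q : conic.

Definition conic_det q : R := sxx q * syy q - sxy q ^+ 2.

Definition posdef q := 0 < sxx q /\ 0 < conic_det q.

(** The bilinear form of the matrix [S^-1], written with the cofactors of
    [S]. *)
Definition polar q z w : R :=
  (syy q * (z.1 * w.1) - sxy q * (z.1 * w.2 + z.2 * w.1)
   + sxx q * (z.2 * w.2)) / conic_det q.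

Definition conic_form q z : R := polar q (z - conic_center q) (z - conic_center q).

(** The last clause records the change of the determinant of [S] under the
    affine change of coordinates, which makes areas comparable in any frame. *)
Definition in_frame e o u v q :=
  [/\ posdef q, forall z, ellipse_form e (frame o u v z) = conic_form q z &
      conic_det q * cross u v ^+ 2 = (semi1 e * semi2 e) ^+ 2].

Lemma addpE (x1 x2 y1 y2 : R) : (x1, x2) + (y1, y2) = (x1 + y1, x2 + y2).
Proof. by []. Qed.

Lemma opppE (x1 x2 : R) : - (x1, x2) = (- x1, - x2).
Proof. by []. Qed.

Lemma scalepE (k x1 x2 : R) : k *: (x1, x2) = (k * x1, k * x2).
Proof. by []. Qed.

Lemma scaleRE (k x : R) : k *: (x : R^o) = k * x.
Proof. by []. Qed.

(** Turns vector expressions between explicit pairs into coordinates, on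
    which [ring] and [field] can work. *)
Definition pairE := (scalepE, opppE, addpE, scaleRE).

Definition frame_coord o u v z : R * R :=
  (cross (z - o) v / cross u v, cross u (z - o) / cross u v).

Lemma frame_coordK o u v : cross u v != 0 ->
  cancel (frame_coord o u v) (frame o u v).
Proof.
case: o u v => [p1 p2] [u1 u2] [v1 v2]; rewrite /cross /= => J [x y].
rewrite /frame_coord /frame /cross !pairE/=.
by congr pair; field.
Qed.

Lemma frame_segment o u v t z w :
  (1 - t) *: frame o u v z + t *: frame o u v w =
  frame o u v ((1 - t) *: z + t *: w).
Proof.
case: o u v z w => [p1 p2] [u1 u2] [v1 v2] [z1 z2] [w1 w2].
rewrite /frame !pairE /=.
by congr pair; ring.
Qed.

Lemma det_polar q z w : conic_det q != 0 -> conic_det q * polar q z w =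
  syy q * (z.1 * w.1) - sxy q * (z.1 * w.2 + z.2 * w.1) + sxx q * (z.2 * w.2).
Proof. by move=> q0; rewrite mulrC divfK. Qed.

Lemma polar0 q z : polar q z 0 = 0.
Proof.
by rewrite (_ : 0 = (0, 0))// /polar /=; ring.
Qed.

Lemma polarZ q z k w : polar q z (k *: w) = k * polar q z w.
Proof. by case: w => ? ?; rewrite /polar pairE /=; ring. Qed.

Lemma conic_form_line q z w h :
  conic_form q (z + h *: w) =
  conic_form q z + h * (polar q (z - conic_center q) w *+ 2) + h ^+ 2 * polar q w w.
Proof.
case: q => [[m1 m2] s11 s12 s22]; case: z w => [z1 z2] [w1 w2].
rewrite /conic_form /polar /= !pairE /=.
by ring.
Qed.

(** Lagrange's identity, which plays here the part of the Cauchy-Schwarz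
    inequality for the scalar product [polar q]. *)
Lemma lagrange_polar q z w : posdef q ->
  cross z w ^+ 2 = conic_det q * (polar q z z * polar q w w - polar q z w ^+ 2).
Proof.
move=> [_ q0].
have : conic_det q != 0 by rewrite gt_eqF.
by rewrite /polar /cross /conic_det => ?; field.
Qed.

Lemma polar_gt0 q z : posdef q -> z != 0 -> 0 < polar q z z.
Proof.
case: q z => m s t r [z1 z2] [/= s0 q0] z0.
rewrite divr_gt0//= -(pmulr_rgt0 _ s0).
have -> : s * (r * (z1 * z1) - t * (z1 * z2 + z2 * z1) + s * (z2 * z2)) =
    (s * r - t ^+ 2) * z1 ^+ 2 + (s * z2 - t * z1) ^+ 2 by ring.
have [z10|z10] := eqVneq z1 0.
  have z20 : z2 != 0 by apply: contra_neq z0 => ->; rewrite z10.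
  rewrite z10 expr0n mulr0 mulr0 add0r subr0.
  by rewrite exprn_even_gt0// mulf_neq0// gt_eqF.
by rewrite ltr_pwDl ?sqr_ge0// mulr_gt0// exprn_even_gt0.
Qed.

Lemma cross_segment z0 z1 t m :
  cross ((1 - t) *: z0 + t *: z1 - m) (z1 - z0) = cross (z0 - m) (z1 - z0).
Proof.
by case: z0 z1 m => [? ?] [? ?] [? ?]; rewrite /cross !pairE /=; ring.
Qed.

(** With [n] orthogonal to [z1 - z0] this is [(n . (z0 - m))^2 = n^T S n],
    the condition for the line through [z0] and [z1] to be tangent. *)
Definition touches q z0 z1 :=
  cross (z0 - conic_center q) (z1 - z0) ^+ 2 = conic_det q * polar q (z1 - z0) (z1 - z0).

(** At the point of contact the form is [1] and the mixed term of Lagrange's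
    identity vanishes, which leaves the tangency condition of the line. *)
Lemma tangent_touches q z0 z1 t : posdef q ->
  let w := (1 - t) *: z0 + t *: z1 in
  conic_form q w = 1 -> polar q (w - conic_center q) (z1 - z0) = 0 -> touches q z0 z1.
Proof.
move=> q0 w qw pw; rewrite /touches -(cross_segment _ _ t).
by rewrite (lagrange_polar _ _ q0) [polar q (w - _) (w - _)]qw pw expr0n/= subr0 mul1r.
Qed.

(** A tangent line leaves the whole elliptic disk on the side of the center:
    by Lagrange's identity, the component of [z - m] transverse to the line is
    at most that of [z0 - m] in absolute value. *)
Lemma touches_support q z0 z1 z : posdef q -> touches q z0 z1 ->
  conic_form q z <= 1 ->
  0 <= cross (z - z0) (z1 - z0) * cross (conic_center q - z0) (z1 - z0).
Proof.
move=> q0 tq qz.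
have -> : cross (conic_center q - z0) (z1 - z0) = - cross (z0 - conic_center q) (z1 - z0).
  case: q z0 z1 {q0 tq qz} => [[m1 m2] s11 s12 s22] [x1 x2] [y1 y2].
  by rewrite /cross !pairE /=; ring.
have -> : cross (z - z0) (z1 - z0) =
    cross (z - conic_center q) (z1 - z0) - cross (z0 - conic_center q) (z1 - z0).
  case: q z0 z1 z {q0 tq qz} => [[m1 m2] s11 s12 s22] [x1 x2] [y1 y2] [w1 w2].
  by rewrite /cross !pairE /=; ring.
have : cross (z - conic_center q) (z1 - z0) ^+ 2 <= cross (z0 - conic_center q) (z1 - z0) ^+ 2.
  rewrite tq (lagrange_polar _ _ q0) ler_pM2l; last by case: q0.
  have [->|d0] := eqVneq (z1 - z0) 0.
    by rewrite !polar0 mulr0 expr0n subr0.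
  by have := polar_gt0 q0 d0; rewrite -/(conic_form q z); nra.
nra.
Qed.

End Conics.

(** * Every ellipse has a dual matrix in every frame, and conversely *)

Section Reading.
Context (R : realType).
Implicit Types (e : ellipse R) (z o u v d : R * R) (q : conic R).

Lemma polar_angle (x y : R) : exists t : R,
  Num.sqrt (x ^+ 2 + y ^+ 2) * cos t = x /\
  Num.sqrt (x ^+ 2 + y ^+ 2) * sin t = y.
Proof.
set r := Num.sqrt _.
have r2 : r ^+ 2 = x ^+ 2 + y ^+ 2 by rewrite sqr_sqrtr// addr_ge0// sqr_ge0.
have : 0 <= r by exact: sqrtr_ge0.
rewrite le_eqVlt => /predU1P[r0|r0].
  exists 0; rewrite -r0 !mul0r.
  by move: r2; rewrite -r0 => ?; split; nra.
have xr : -1 <= x / r <= 1.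
  rewrite ler_pdivlMr// ler_pdivrMr// mulN1r mul1r -ler_norml.
  by rewrite -(@ler_pXn2r _ 2) ?nnegrE ?(ltW r0)// real_normK ?num_real// r2 lerDl sqr_ge0.
have cosE : cos (acos (x / r)) = x / r by rewrite acosK// in_itv.
have sinE : r * sin (acos (x / r)) = `|y|.
  rewrite sin_acos// -[X in X * _](ger0_norm (ltW r0)) -sqrtr_sqr -sqrtrM ?sqr_ge0//.
  rewrite -sqrtr_sqr; congr Num.sqrt.
  have -> : r ^+ 2 * (1 - (x / r) ^+ 2) = r ^+ 2 - x ^+ 2.
    by field; rewrite gt_eqF.
  by rewrite r2; ring.
have [y0|y0] := leP 0 y.
  exists (acos (x / r)); rewrite cosE sinE ger0_norm//.
  by rewrite mulrC divfK ?gt_eqF.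
exists (- acos (x / r)); rewrite cosN sinN cosE mulrN sinE ltr0_norm// opprK.
by rewrite mulrC divfK ?gt_eqF.
Qed.

(** The required angle is half the argument of [(A - C, 2 B)], and the
    inverse squares of the semi-axes are the eigenvalues [(A + C +/- r) / 2],
    where [r] is the modulus of that vector. *)
Lemma principal_axes (A B C : R) : 0 < A -> 0 < A * C - B ^+ 2 ->
  exists t l1 l2 : R, [/\ 0 < l1, 0 < l2,
    (l1 * l2) ^+ 2 = (A * C - B ^+ 2)^-1 & forall x y,
    ((x * cos t + y * sin t) / l1) ^+ 2 + ((y * cos t - x * sin t) / l2) ^+ 2 =
    A * x ^+ 2 + B * (x * y) *+ 2 + C * y ^+ 2].
Proof.
move=> A0 D0.
have C0 : 0 < C by nra.
have [t2] := polar_angle (A - C) (B *+ 2).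
set r := Num.sqrt _; pose t := t2 / 2.
have t2E : t2 = t + t by rewrite /t -splitr.
rewrite t2E cosD sinD => -[cosE sinE].
have cs := cos2Dsin2 t.
have r0 : 0 <= r by exact: sqrtr_ge0.
have r2 : r ^+ 2 = (A - C) ^+ 2 + (B *+ 2) ^+ 2.
  by rewrite sqr_sqrtr// addr_ge0// sqr_ge0.
have rAC : r < A + C by rewrite -(@ltr_pXn2r _ 2) ?nnegrE//; nra.
pose m1 := (A + C + r) / 2; pose m2 := (A + C - r) / 2.
have m10 : 0 < m1 by rewrite /m1; lra.
have m20 : 0 < m2 by rewrite /m2; lra.
exists t, (Num.sqrt m1)^-1, (Num.sqrt m2)^-1.
split; rewrite ?invr_gt0 ?sqrtr_gt0//.
  rewrite -invfM exprVn exprMn !sqr_sqrtr ?ltW//; congr (_ ^-1).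
  rewrite (_ : m1 * m2 = ((A + C) ^+ 2 - r ^+ 2) / 4); last by rewrite /m1 /m2; field.
  by rewrite r2; field.
move=> x y; rewrite !invrK 2!exprMn !sqr_sqrtr ?ltW//.
have AE : A = m1 * cos t ^+ 2 + m2 * sin t ^+ 2 by rewrite /m1 /m2; nra.
have CE : C = m1 * sin t ^+ 2 + m2 * cos t ^+ 2 by rewrite /m1 /m2; nra.
have BE : B = (m1 - m2) * (cos t * sin t) by rewrite /m1 /m2; nra.
by rewrite [in RHS]AE [in RHS]BE [in RHS]CE; ring.
Qed.

Lemma conic_of_form m (A B C : R) : 0 < A -> 0 < A * C - B ^+ 2 ->
  exists q, [/\ posdef q, conic_center q = m, conic_det q = (A * C - B ^+ 2)^-1 &
    forall z w, polar q z w =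
      A * (z.1 * w.1) + B * (z.1 * w.2 + z.2 * w.1) + C * (z.2 * w.2)].
Proof.
move=> A0; set D := A * C - _ => D0.
have Dn : D != 0 by rewrite gt_eqF.
have C0 : 0 < C by rewrite /D in D0; nra.
pose q := Conic m (C / D) (- B / D) (A / D).
have dq : conic_det q = D^-1.
  rewrite /conic_det /=.
  have -> : C / D * (A / D) - (- B / D) ^+ 2 = D * D^-1 ^+ 2 by rewrite /D; ring.
  by rewrite expr2 mulrA divff// mul1r.
exists q; split => //; first by split; rewrite ?dq ?invr_gt0// /q /= divr_gt0.
by move=> z w; rewrite /polar dq invrK /=; field.
Qed.

(** In the orthonormal axes of the ellipse, each axis being scaled by its
    semi-axis, the form is a sum of two squares; the images of [u] and [v] in
    these coordinates give its coefficients in the frame. *)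
Lemma in_frame_exists e o u v : cross u v != 0 ->
  exists q, in_frame e o u v q.
Proof.
move=> J; have s1 := semi1_gt0 e; have s2 := semi2_gt0 e.
pose X (z : R * R) := (z.1 * cos (tilt e) + z.2 * sin (tilt e)) / semi1 e.
pose Y (z : R * R) := (z.2 * cos (tilt e) - z.1 * sin (tilt e)) / semi2 e.
have XY : X u * Y v - Y u * X v = cross u v / (semi1 e * semi2 e).
  rewrite -[cross u v]mulr1 -(cos2Dsin2 (tilt e)) /X /Y /cross; field.
  by rewrite !gt_eqF.
pose A := X u ^+ 2 + Y u ^+ 2; pose B := X u * X v + Y u * Y v.
pose C := X v ^+ 2 + Y v ^+ 2.
have DE : A * C - B ^+ 2 = (cross u v / (semi1 e * semi2 e)) ^+ 2.
  by rewrite -XY /A /B /C; ring.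
have D0 : 0 < A * C - B ^+ 2.
  by rewrite DE exprn_even_gt0//= mulf_neq0// invr_neq0// mulf_neq0 ?gt_eqF.
have A0 : 0 < A.
  rewrite lt_def addr_ge0 ?sqr_ge0// andbT; apply: contraL D0 => /eqP ->.
  by rewrite mul0r sub0r oppr_gt0 -leNgt sqr_ge0.
have [m cE] : exists m, Defs.center e = frame o u v m.
  by exists (frame_coord o u v (Defs.center e)); rewrite frame_coordK.
have [q [q0 qm qd qp]] := conic_of_form m A0 D0.
exists q; split=> // [z|]; last by rewrite qd DE; field; rewrite J !gt_eqF.
rewrite /conic_form qp qm.
rewrite /ellipse_form cE /A /B /C /X /Y /frame /=.
case: o u v z m {J XY A B C DE D0 A0 cE qm qd qp} => [p1 p2] [u1 u2] [v1 v2] [x y] [m1 m2].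
rewrite !pairE /=; field.
by rewrite !gt_eqF.
Qed.

(** The form is carried back to the ambient coordinates by the cofactors
    [U], [W] of the frame, where it can be diagonalized by a rotation. *)
Lemma in_frame_realizable o u v q : cross u v != 0 -> posdef q ->
  exists e, in_frame e o u v q.
Proof.
move=> J q0; set J' := cross u v in J.
pose U : R * R := (v.2, - u.2); pose W : R * R := (- v.1, u.1).
have Un : U != 0.
  apply: contraNneq J => -[v2 /eqP]; rewrite oppr_eq0 => /eqP u2.
  by rewrite /J' /cross v2 u2; apply/eqP; ring.
have A0 : 0 < polar q U U / J' ^+ 2.
  by rewrite divr_gt0 ?polar_gt0// exprn_even_gt0.
have dz : 0 < conic_det q := q0.2.
have DE : polar q U U / J' ^+ 2 * (polar q W W / J' ^+ 2)
              - (polar q U W / J' ^+ 2) ^+ 2 = (conic_det q * J' ^+ 2)^-1.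
  have JUW : cross U W = J' by rewrite /cross /= /J' /cross; ring.
  have cUW : cross U W != 0 by rewrite JUW.
  rewrite -JUW.
  apply: (mulfI (lt0r_neq0 dz)).
  transitivity (conic_det q * (polar q U U * polar q W W - polar q U W ^+ 2) /
                (cross U W ^+ 2) ^+ 2); first by field.
  by rewrite -(lagrange_polar _ _ q0); field; rewrite cUW gt_eqF.
have D0 : 0 < polar q U U / J' ^+ 2 * (polar q W W / J' ^+ 2)
              - (polar q U W / J' ^+ 2) ^+ 2.
  by rewrite DE invr_gt0 mulr_gt0// exprn_even_gt0.
have [t [l1 [l2 [l10 l20 l12 E]]]] := principal_axes A0 D0.
exists (Ellipse (frame o u v (conic_center q)) t l10 l20).
split=> // [z|]; last by rewrite /= l12 DE invrK.
rewrite /ellipse_form /= E {l12 DE}.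
rewrite /conic_form /polar /J' /cross /U /W /frame /= in J *.
case: q o u v z {J' q0 U W Un A0 D0 E} J dz =>
  [[m1 m2] s11 s12 s22] [p1 p2] [u1 u2] [v1 v2] [x y] /= J dz.
rewrite !pairE /=; field.
by rewrite gt_eqF.
Qed.

End Reading.

(** * Tangency along a segment *)

Section Tangency.
Context (R : realType).
Implicit Types (e : ellipse R) (z o u v d : R * R) (q : conic R).

(** The restriction of the form of an ellipse to a line is a quadratic
    polynomial, so that its directional derivative is read off as a coefficient,
    without appealing to differentiability. *)
Lemma derive_quadratic (f : R * R -> R) (p d : R * R) (b c : R) :
  (forall h, f (p + h *: d) = f p + h * b + h ^+ 2 * c) -> 'D_d f p = b.
Proof.
move=> fE; rewrite /derive; apply: cvg_lim => //.
apply: (@cvg_trans _ ((fun h : R => b + h * c) @ 0^')).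
  apply: near_eq_cvg; near=> h.
  have h0 : h != 0 by near: h; exact: nbhs_dnbhs_neq.
  rewrite /= [h *: d + p]addrC fE /GRing.scale /=; field.
  exact: h0.
apply: cvg_within_filter.
suff : (fun h : R => b + h * c) @ 0 --> b + 0 * c by rewrite mul0r addr0.
by apply: cvgD; [exact: cvg_cst|apply: cvgM; [exact: cvg_id|exact: cvg_cst]].
Unshelve. all: by end_near.
Qed.

Definition tangent_at q z0 z1 (t : R) :=
  let w := (1 - t) *: z0 + t *: z1 in
  [/\ 0 <= t <= 1, conic_form q w = 1 & polar q (w - conic_center q) (z1 - z0) = 0].

Lemma tangent_to_sideE (V : 'I_4 -> R * R) e i o u v q z0 z1 :
  in_frame e o u v q -> V i = frame o u v z0 -> V (i + 1) = frame o u v z1 ->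
  tangent_to_side V e i <-> exists t, tangent_at q z0 z1 t.
Proof.
move=> [q0 eE _] V0 V1.
have DE w : 'D_(V (i + 1) - V i) (ellipse_form e) (frame o u v w) =
    polar q (w - conic_center q) (z1 - z0) *+ 2.
  apply: (@derive_quadratic _ _ _ _ (polar q (z1 - z0) (z1 - z0))) => h.
  have -> : frame o u v w + h *: (V (i + 1) - V i) =
      frame o u v (w + h *: (z1 - z0)).
    rewrite V0 V1 /frame.
    case: o u v w z0 z1 {eE V0 V1} => [? ?] [? ?] [? ?] [? ?] [? ?] [? ?].
    by rewrite !pairE /=; congr pair; ring.
  by rewrite !eE conic_form_line.
split.
  move=> [p [pe [t t01 pE] pd]]; move: pe pd.
  rewrite -pE V0 V1 frame_segment -{1}V0 -{1}V1 /ellipse_curve /= => pe.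
  rewrite DE => /eqP; rewrite mulrn_eq0 /= => /eqP pd.
  exists t; split; [by move: t01; rewrite /= in_itv| |exact: pd].
  by rewrite -eE.
move=> [t [t01 qw pw]].
exists (frame o u v ((1 - t) *: z0 + t *: z1)); split.
- by rewrite /ellipse_curve /= eE.
- by exists t; rewrite ?V0 ?V1 ?frame_segment//= in_itv.
- by rewrite DE pw mul0rn.
Qed.

End Tangency.

(** * The pencil of conics tangent to four lines *)

Section Family.
Context (R : realType).
Implicit Types (z : R * R) (q : conic R) (a b c d k : R).

(** [S = m m^T + diag (- k a c, - (1 - k) b d)], where the center [m] runs
    along the line joining the midpoints of the two diagonals. *)
Definition newton_conic a c b d k : conic R :=
  let x := k * (a + c) / 2 in let y := (1 - k) * (b + d) / 2 in
  Conic (x, y) (x ^+ 2 - k * (a * c)) (x * y) (y ^+ 2 - (1 - k) * (b * d)).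

(** The two symmetries of the pencil: they deduce the statements on the four
    sides from the one on the side from [(a, 0)] to [(0, b)]. *)
Lemma newton_conicCl a c b d k : newton_conic a c b d k = newton_conic c a b d k.
Proof. by rewrite /newton_conic (addrC a) (mulrC a). Qed.

Lemma newton_conicCr a c b d k : newton_conic a c b d k = newton_conic a c d b k.
Proof. by rewrite /newton_conic (addrC b) (mulrC b). Qed.

(** The factor [k (1 - k)] reflects that the conic flattens onto the second
    diagonal at [k = 0] and onto the first one at [k = 1]. *)
Lemma det_newton a c b d k : conic_det (newton_conic a c b d k) =
  k * (1 - k) * ((1 - k) * (- (a * c) * ((d - b) / 2) ^+ 2)
                 + k * (- (b * d) * ((c - a) / 2) ^+ 2)).
Proof. by rewrite /conic_det /=; field. Qed.

Lemma posdef_newton a c b d k : a * c < 0 -> b * d < 0 -> 0 < k < 1 ->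
  posdef (newton_conic a c b d k).
Proof.
move=> ac bd /andP[k0 k1]; split.
  by rewrite /= -mulrN ltr_wpDl ?sqr_ge0// mulr_gt0// oppr_gt0.
have k1' : 0 < 1 - k by rewrite subr_gt0.
have ca : 0 < ((c - a) / 2) ^+ 2 by rewrite expr_div_n divr_gt0//; nra.
have db : 0 < ((d - b) / 2) ^+ 2 by rewrite expr_div_n divr_gt0//; nra.
rewrite det_newton; apply: mulr_gt0; first exact: mulr_gt0.
by apply: addr_gt0; apply: mulr_gt0 => //; apply: mulr_gt0; rewrite ?oppr_gt0.
Qed.

(** The point of contact with the side from [(a, 0)] to [(0, b)] divides it
    according to the two terms of this sum. *)
Definition contact_weight a c b d k : R := k * (b * (a - c)) + (1 - k) * (a * (b - d)).

Lemma cross_newton a c b d k :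
  cross ((a, 0) - conic_center (newton_conic a c b d k)) ((0, b) - (a, 0)) =
  contact_weight a c b d k / 2.
Proof. by rewrite /cross /contact_weight !pairE /=; field. Qed.

Lemma touches_newton a c b d k : conic_det (newton_conic a c b d k) != 0 ->
  touches (newton_conic a c b d k) (a, 0) (0, b).
Proof.
move=> q0; rewrite /touches cross_newton det_polar//.
by rewrite /contact_weight !pairE /=; field.
Qed.

(** Seen along the side, the polar condition for the point of parameter [t]
    to be the point of contact is an affine equation in [t], whose root is the
    ratio of the second term of [contact_weight] to the sum. *)
Lemma newton_contact a c b d k t : conic_det (newton_conic a c b d k) != 0 ->
  let q := newton_conic a c b d k in
  let w := (1 - t) *: (a, 0) + t *: (0, b) in
  conic_det q * polar q (w - conic_center q) ((0, b) - (a, 0)) =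
  contact_weight a c b d k *
    (t * contact_weight a c b d k - (1 - k) * (a * (b - d))) / 4.
Proof.
move=> q0 q w; rewrite det_polar// /w /q.
by rewrite /contact_weight !pairE /=; field.
Qed.

Lemma segment_dir_neq0 a b : a != 0 -> (0, b) - (a, 0) != 0.
Proof.
by move=> a0; apply: contra_neq a0 => /(congr1 fst) /= /eqP; rewrite sub0r oppr_eq0 => /eqP.
Qed.

(** The point of contact is the one that [newton_contact] dictates;
    Lagrange's identity, read backwards, then deduces from the tangency of the
    line that this point is on the conic. *)
Lemma tangent_newton a c b d k : a * c < 0 -> b * d < 0 -> 0 < k < 1 ->
  exists t, tangent_at (newton_conic a c b d k) (a, 0) (0, b) t.
Proof.
move=> ac bd k01; have q0 := posdef_newton ac bd k01.
set q := newton_conic _ _ _ _ _ in q0 *.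
have a0 : a != 0 by apply: contraTneq ac => ->; rewrite mul0r ltxx.
have dq : conic_det q != 0 by rewrite gt_eqF// q0.2.
case/andP: k01 => k0 k1.
pose s := contact_weight a c b d k.
pose g := (1 - k) * (a * (b - d)).
(* The two terms of the weight have the same sign, hence the ratio of one of
   them to the sum is between [0] and [1]. *)
have gs : 0 <= g * (s - g).
  have -> : g * (s - g) =
      (k * (1 - k)) * ((b ^+ 2 - b * d) * (a ^+ 2 - a * c)).
    by rewrite /g /s /contact_weight; ring.
  rewrite mulr_ge0//; first by apply: mulr_ge0; lra.
  by apply: mulr_ge0; nra.
have tq := touches_newton dq; rewrite -/q in tq.
have pd := polar_gt0 q0 (segment_dir_neq0 b a0).
have s0 : s != 0.
  apply: contraTneq pd => s0; rewrite -leNgt -(pmulr_rle0 _ q0.2) -tq.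
  by rewrite cross_newton -/s s0 mul0r expr0n.
have pw : polar q ((1 - g / s) *: (a, 0) + (g / s) *: (0, b) - conic_center q)
   ((0, b) - (a, 0)) = 0.
  apply: (mulfI dq); rewrite newton_contact// -/s mulr0.
  by rewrite divfK// subrr mulr0 mul0r.
exists (g / s); split => //.
  have s20 : 0 < s ^+ 2 by rewrite exprn_even_gt0.
  have -> : g / s = g * s / s ^+ 2 by field.
  by rewrite ler_pdivlMr// ler_pdivrMr// mul0r mul1r; apply/andP; split; nra.
have := tq; rewrite /touches -(cross_segment _ _ (g / s)) (lagrange_polar _ _ q0) pw expr0n subr0.
move/(mulfI dq); rewrite -[X in _ = X]mul1r.
by move/(mulIf (lt0r_neq0 pd)).
Qed.

(** The two terms of [contact_weight] are [k] and [1 - k] times positive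
    numbers. If the point of contact is on the side, they have the same sign,
    which has to be positive because [k + (1 - k) = 1]. This excludes the conics
    that touch the side lines outside the quadrilateral. *)
Lemma tangent_newton_range a c b d k t : a < 0 < c -> b < 0 < d ->
  posdef (newton_conic a c b d k) ->
  tangent_at (newton_conic a c b d k) (a, 0) (0, b) t -> 0 < k < 1.
Proof.
move=> /andP[a0 c0] /andP[b0 d0]; set q := newton_conic _ _ _ _ _ => q0.
have dq : conic_det q != 0 by rewrite gt_eqF// q0.2.
move=> [/andP[t0 t1] _ pw].
have := newton_contact t dq; rewrite /= pw mulr0 => /esym/eqP.
set s := contact_weight a c b d k.
have s0 : s != 0.
  have an : a != 0 by rewrite lt_eqF.
  have pd := polar_gt0 q0 (segment_dir_neq0 b an).
  apply: contraTneq pd => s0; rewrite -leNgt -(pmulr_rle0 _ q0.2) -touches_newton//.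
  by rewrite cross_newton -/s s0 mul0r expr0n.
rewrite !mulf_eq0 (negbTE s0) invr_eq0 pnatr_eq0 orbF /= subr_eq0 => /eqP ts.
have P0 : 0 < b * (a - c) by nra.
have Q0 : 0 < a * (b - d) by nra.
have ts' : (1 - t) * s = k * (b * (a - c)).
  by rewrite mulrBl mul1r ts /s /contact_weight; ring.
have [k0 k1] : k != 0 /\ 1 - k != 0.
  by move: dq; rewrite det_newton !mulf_eq0 !negb_or => /andP[/andP[]].
have {}k0 : k < 0 \/ 0 < k by case: (ltrgtP k 0) k0; [left|right|].
have {}k1 : 1 - k < 0 \/ 0 < 1 - k by case: (ltrgtP (1 - k) 0) k1; [left|right|].
have [s1|s1] : s < 0 \/ 0 < s by case: (ltrgtP s 0) s0; [left|right|].
- have A : k * (b * (a - c)) <= 0 by rewrite -ts'; nra.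
  have B : (1 - k) * (a * (b - d)) <= 0 by rewrite -ts; nra.
  by move: A B; rewrite (pmulr_lle0 _ P0) (pmulr_lle0 _ Q0); lra.
- have A : 0 <= k * (b * (a - c)) by rewrite -ts'; nra.
  have B : 0 <= (1 - k) * (a * (b - d)) by rewrite -ts; nra.
  move: A B; rewrite (pmulr_lge0 _ P0) (pmulr_lge0 _ Q0) => A B.
  by apply/andP; split; lra.
Qed.

Lemma newton_support a c b d k z : a * c < 0 -> b * d < 0 -> 0 < k < 1 ->
  conic_form (newton_conic a c b d k) z <= 1 -> z.1 / a + z.2 / b <= 1.
Proof.
move=> ac bd k01 qz; have q0 := posdef_newton ac bd k01.
have a0 : a != 0 by apply: contraTneq ac => ->; rewrite mul0r ltxx.
have b0 : b != 0 by apply: contraTneq bd => ->; rewrite mul0r ltxx.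
have dq := lt0r_neq0 q0.2.
have := touches_support q0 (touches_newton dq) qz.
set q := newton_conic _ _ _ _ _ in q0 qz dq *.
have -> : cross (conic_center q - (a, 0)) ((0, b) - (a, 0)) = - (contact_weight a c b d k / 2).
  by rewrite -cross_newton /cross !pairE /=; ring.
have -> : contact_weight a c b d k =
    a * b * (k * (1 - c / a) + (1 - k) * (1 - d / b)).
  by rewrite /contact_weight; field; rewrite a0 b0.
have -> : cross (z - (a, 0)) ((0, b) - (a, 0)) = a * b * (z.1 / a + z.2 / b - 1).
  by case: z {qz} => x y; rewrite /cross !pairE /=; field; rewrite a0 b0.
set f := k * _ + _; set g := _ - 1.
have -> : a * b * g * - (a * b * f / 2) = (a * b) ^+ 2 * f / 2 * (- g) by field.
case/andP: k01 => k0 k1.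
have ca : c / a < 0.
  have -> : c / a = a * c / a ^+ 2 by field.
  by rewrite pmulr_llt0// invr_gt0 exprn_even_gt0.
have db : d / b < 0.
  have -> : d / b = b * d / b ^+ 2 by field.
  by rewrite pmulr_llt0// invr_gt0 exprn_even_gt0.
have f0 : 0 < f by rewrite /f addr_gt0// mulr_gt0//; lra.
rewrite pmulr_rge0; first by rewrite oppr_ge0 /g subr_le0.
by rewrite divr_gt0// mulr_gt0// exprn_even_gt0// mulf_neq0.
Qed.

(** The tangency condition in terms of the entries of [S - m m^T]: it is
    affine in these entries and in [m]. *)
Lemma touchesE a b q : posdef q -> a != 0 -> b != 0 -> touches q (a, 0) (0, b) ->
  let x := (conic_center q).1 in let y := (conic_center q).2 in
  (sxx q - x ^+ 2) / a ^+ 2 + (sxy q - x * y) / (a * b) *+ 2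
  + (syy q - y ^+ 2) / b ^+ 2 + x / a *+ 2 + y / b *+ 2 = 1.
Proof.
move=> q0 a0 b0; have dq := lt0r_neq0 q0.2.
rewrite /touches det_polar//.
case: q {q0 dq} => [[x y] s t r]; rewrite /cross !pairE /= => E.
apply/eqP; rewrite -subr_eq0; apply/eqP.
transitivity (((a ^+ 2 * b ^+ 2)^-1) * ((r * ((0 - a) * (0 - a)) -
  t * ((0 - a) * (b - 0) + (b - 0) * (0 - a)) + s * ((b - 0) * (b - 0)))
  - ((a - x) * (b - 0) - (0 - y) * (0 - a)) ^+ 2)).
  by field; rewrite a0 b0.
by rewrite E subrr mulr0.
Qed.

Lemma touches_sym q z0 z1 : touches q z0 z1 -> touches q z1 z0.
Proof.
rewrite /touches /polar.
case: q z0 z1 => [[m1 m2] s t r] [x1 y1] [x2 y2].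
rewrite /cross !pairE /= => E.
transitivity (((x1 - m1) * (y2 - y1) - (y1 - m2) * (x2 - x1)) ^+ 2); first by ring.
by rewrite E; ring.
Qed.

(** In the four equations of [touchesE] the off-diagonal entry [T] of
    [S - m m^T] is isolated by an alternating sum. Once it is zero the equations
    separate: [1 / a] and [1 / c] are the roots of one quadratic polynomial,
    [1 / b] and [1 / d] those of another, whose constant terms add up to [-1].
    *)
Lemma touches_newton_conic a c b d q : a < 0 < c -> b < 0 < d -> posdef q ->
  touches q (a, 0) (0, b) -> touches q (0, b) (c, 0) ->
  touches q (c, 0) (0, d) -> touches q (0, d) (a, 0) ->
  exists k, q = newton_conic a c b d k.
Proof.
move=> /andP[a0 c0] /andP[b0 d0] q0 tab tbc tcd tda.
have an : a != 0 by rewrite lt_eqF.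
have bn : b != 0 by rewrite lt_eqF.
have cn : c != 0 by rewrite gt_eqF.
have dn : d != 0 by rewrite gt_eqF.
have := touchesE q0 an bn tab.
have := touchesE q0 cn bn (touches_sym tbc).
have := touchesE q0 cn dn tcd.
have := touchesE q0 an dn (touches_sym tda).
case: q {q0 tab tbc tcd tda} => [[x y] s t r] /=.
set S := s - _; set T := t - _; set W := r - _ => ad cd cb ab.
have T0 : T = 0.
  suff /eqP : T * ((c - a) * (d - b)) = 0.
    have ca : (c - a) * (d - b) != 0.
      by rewrite mulf_neq0// subr_eq0 gt_eqF// (lt_trans a0, lt_trans b0).
    by rewrite mulf_eq0 (negbTE ca) orbF => /eqP.
  have -> : T * ((c - a) * (d - b)) = (a * b * c * d) / 2 *
     ((S / a ^+ 2 + T / (a * b) *+ 2 + W / b ^+ 2 + x / a *+ 2 + y / b *+ 2)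
    - (S / c ^+ 2 + T / (c * b) *+ 2 + W / b ^+ 2 + x / c *+ 2 + y / b *+ 2)
    - (S / a ^+ 2 + T / (a * d) *+ 2 + W / d ^+ 2 + x / a *+ 2 + y / d *+ 2)
    + (S / c ^+ 2 + T / (c * d) *+ 2 + W / d ^+ 2 + x / c *+ 2 + y / d *+ 2)).
    by field; rewrite an bn cn dn.
  by rewrite ad cd cb ab; ring.
(* The constant term common to the equations in [1 / a] and [1 / c], by the
   product of the roots. *)
pose k := - S / (a * c).
have SE : S = - (k * (a * c)) by rewrite /k; field; rewrite an cn.
have xE : x = k * (a + c) / 2.
  have /eqP : (x - k * (a + c) / 2) * (c - a) = 0.
    have -> : (x - k * (a + c) / 2) * (c - a) = (a * c) / 2 *
       ((S / a ^+ 2 + T / (a * b) *+ 2 + W / b ^+ 2 + x / a *+ 2 + y / b *+ 2)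
      - (S / c ^+ 2 + T / (c * b) *+ 2 + W / b ^+ 2 + x / c *+ 2 + y / b *+ 2)).
      by rewrite T0 /k; field; rewrite an bn cn.
    by rewrite cb ab; ring.
  by rewrite mulf_eq0 !subr_eq0 (gt_eqF (lt_trans a0 c0)) orbF => /eqP.
have kE : S / a ^+ 2 + x / a *+ 2 = k.
  by rewrite SE xE; field; rewrite an.
have ab' : W / b ^+ 2 + y / b *+ 2 = 1 - k by rewrite -ab T0 -kE; ring.
have ad' : W / d ^+ 2 + y / d *+ 2 = 1 - k by rewrite -ad T0 -kE; ring.
have yE : y = (1 - k) * (b + d) / 2.
  have /eqP : (y - (1 - k) * (b + d) / 2) * (d - b) = 0.
    transitivity ((b ^+ 2 * (W / b ^+ 2 + y / b *+ 2 - (1 - k))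
      - d ^+ 2 * (W / d ^+ 2 + y / d *+ 2 - (1 - k))) / - 2).
      by field; rewrite bn dn.
    by rewrite ab' ad'; ring.
  by rewrite mulf_eq0 !subr_eq0 (gt_eqF (lt_trans b0 d0)) orbF => /eqP.
have WE : W = - ((1 - k) * (b * d)).
  transitivity (b ^+ 2 * (W / b ^+ 2 + y / b *+ 2) - 2 * b * y).
    by field.
  by rewrite ab' yE; field.
exists k; rewrite /newton_conic -xE -yE -SE -WE.
congr Conic; [by rewrite /S; ring| |by rewrite /W; ring].
by apply/eqP; rewrite -subr_eq0; apply/eqP.
Qed.

End Family.

(** * Quadrilaterals in the frame of their diagonals *)

Section Quadrilaterals.
Context (R : realType) (V : 'I_4 -> R * R).
Implicit Types (e : ellipse R) (z o u v : R * R) (q : conic R) (a b c d k : R).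

Lemma ord4P (P : 'I_4 -> Prop) : P 0 -> P 1 -> P 2 -> P 3 -> forall i, P i.
Proof.
move=> P0 P1 P2 P3 [[|[|[|[|//]]]] i4].
- by rewrite (_ : Ordinal i4 = 0)//; exact: val_inj.
- by rewrite (_ : Ordinal i4 = 1)//; exact: val_inj.
- by rewrite (_ : Ordinal i4 = 2)//; exact: val_inj.
- by rewrite (_ : Ordinal i4 = 3)//; exact: val_inj.
Qed.

Lemma sum_ord4 (M : nmodType) (F : 'I_4 -> M) :
  \sum_i F i = F 0 + F 1 + F 2 + F 3.
Proof.
rewrite !big_ord_recl big_ord0 addr0 !addrA.
by congr (_ + F _ + F _ + F _); exact: val_inj.
Qed.

Definition diagonal_frame o u v a b c d :=
  [/\ cross u v != 0, a < 0 < c, b < 0 < d &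
   [/\ V 0 = frame o u v (a, 0), V 1 = frame o u v (0, b),
       V 2 = frame o u v (c, 0) & V 3 = frame o u v (0, d)]].

(** The frame has its origin at the intersection of the diagonals, and the
    diagonals as basis vectors. Convexity says that the four triangles cut out
    by three vertices have the same orientation, and the coordinates of the
    vertices are quotients of their areas by the area of the quadrilateral. *)
Lemma convex_diagonal_frame : convex_quadrilateral V ->
  exists o u v a b c d, diagonal_frame o u v a b c d.
Proof.
move=> cV.
have r22 : 2 + 2 = 0 :> 'I_4 by exact: val_inj.
have r21 : 2 + 1 = 3 :> 'I_4 by exact: val_inj.
have r23 : 2 + 3 = 1 :> 'I_4 by exact: val_inj.
have r13 : 1 + 3 = 0 :> 'I_4 by exact: val_inj.
have r12 : 1 + 2 = 3 :> 'I_4 by exact: val_inj.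
have := cV 0; have := cV 1; have := cV 2.
rewrite !add0r r22 r21 r23 r13 r12 (_ : 1 + 1 = 2)//.
set p := orient (V 0) (V 1) (V 2); set r := orient (V 0) (V 1) (V 3).
have -> : orient (V 1) (V 2) (V 0) = p by rewrite /p /orient; ring.
have -> : orient (V 2) (V 3) (V 1) = orient (V 1) (V 2) (V 3).
  by rewrite /orient; ring.
set s := orient (V 1) (V 2) (V 3); set w := orient (V 2) (V 3) (V 0).
move=> ws sp pr.
have rs : 0 < r * s by nra.
have pw : 0 < p * w by nra.
pose u := V 2 - V 0; pose v := V 3 - V 1.
have Jrs : cross u v = r + s by rewrite /cross /r /s /orient /=; ring.
have Jpw : cross u v = p + w by rewrite /cross /p /w /orient /=; ring.
have ratio_gt0 (x y : R) : 0 < x * y -> 0 < x / (x + y).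
  move=> xy; have xy0 : x + y != 0 by apply: contraTneq xy => xy0; rewrite -leNgt; nra.
  have -> : x / (x + y) = (x ^+ 2 + x * y) / (x + y) ^+ 2 by field.
  by rewrite divr_gt0 ?exprn_even_gt0// ltr_wpDl ?sqr_ge0.
have J : cross u v != 0 by rewrite Jrs; apply: contraTneq rs => rs0; rewrite -leNgt; nra.
exists (V 0 + (r / cross u v) *: u), u, v.
exists (- (r / cross u v)), (- (p / cross u v)), (s / cross u v), (w / cross u v).
split => //.
- by rewrite oppr_lt0 [in r / _]Jrs ratio_gt0// Jrs addrC ratio_gt0// mulrC.
- by rewrite oppr_lt0 [in p / _]Jpw ratio_gt0// Jpw addrC ratio_gt0// mulrC.
have pE (x y : R * R) : x.1 = y.1 -> x.2 = y.2 -> x = y.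
  by case: x y => [? ?] [? ?] /= -> ->.
rewrite /frame /=; split; rewrite ?scale0r ?addr0; apply: pE => /=.
all: rewrite !scaleRE; move: J.
all: by rewrite /p /r /s /w /u /v /cross /orient /= => J; field; exact: J.
Qed.

(** The alternatives are the two signs of [x]; together with the sign of the
    other coordinate they single out the side whose half-plane bounds the total
    weight. *)
Lemma axis_weights a c (x : R) : a < 0 < c -> exists s t : R,
  [/\ 0 <= s, 0 <= t, x = s * a + t * c & s + t = x / a \/ s + t = x / c].
Proof.
move=> /andP[a0 c0]; have [x0|x0] := leP 0 x.
- exists 0, (x / c); rewrite divfK ?gt_eqF// mul0r !add0r divr_ge0 ?(ltW c0)//.
  by split=> //; right.
- exists (x / a), 0; rewrite divfK ?lt_eqF// mul0r !addr0.
  by rewrite nmulr_rge0// invr_le0 ltW//; split=> //; left.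
Qed.

Lemma region_weights (w0 w1 w2 w3 : R) : 0 <= w0 -> 0 <= w1 -> 0 <= w2 -> 0 <= w3 ->
  w0 + w1 + w2 + w3 = 1 ->
  region V (w0 *: V 0 + w1 *: V 1 + w2 *: V 2 + w3 *: V 3).
Proof.
move=> h0 h1 h2 h3 hs; exists (fun i => nth 0 [:: w0; w1; w2; w3] i).
by split; [exact: ord4P|rewrite sum_ord4|rewrite sum_ord4].
Qed.

(** The point lies in one of the four triangles cut out by the diagonals,
    which gives weights of sum at most [1]; what remains goes to the origin,
    itself a convex combination of the vertices on the first axis. *)
Lemma region_frame o u v a b c d z : diagonal_frame o u v a b c d ->
  z.1 / a + z.2 / b <= 1 -> z.1 / c + z.2 / b <= 1 ->
  z.1 / a + z.2 / d <= 1 -> z.1 / c + z.2 / d <= 1 ->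
  region V (frame o u v z).
Proof.
move=> [_ ac bd [V0 V1 V2 V3]].
case: z => [x y] /= ab cb ad cd.
have [wa [wc [wa0 wc0 xE wac]]] := axis_weights x ac.
have [wb [wd [wb0 wd0 yE wbd]]] := axis_weights y bd.
have s1 : wa + wc + (wb + wd) <= 1 by case: wac wbd => [->|->] [->|->].
case/andP: ac => a0 c0; have ca0 : 0 < c - a by lra.
set r := (1 - (wa + wc + (wb + wd))) / (c - a).
have rE : r * (c - a) = 1 - (wa + wc + (wb + wd)) by rewrite divfK ?gt_eqF.
have r0 : 0 <= r by rewrite divr_ge0 ?(ltW ca0)// subr_ge0.
have -> : frame o u v (x, y) =
    (wa + r * c) *: V 0 + wb *: V 1 + (wc - r * a) *: V 2 + wd *: V 3.
  rewrite V0 V1 V2 V3 xE yE /frame.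
  (* The weights have sum [1], so that the origin of the frame drops out. *)
  have oE : 1 = wa + r * c + wb + (wc - r * a) + wd by lra.
  case: o u v {V0 V1 V2 V3} => [p1 p2] [u1 u2] [v1 v2].
  rewrite !pairE /= -[p1 in LHS]mul1r -[p2 in LHS]mul1r oE.
  by congr pair; ring.
by apply: region_weights => //; [nra|nra|lra].
Qed.

Lemma tangent_to_sidesE o u v a b c d e q : diagonal_frame o u v a b c d ->
  in_frame e o u v q -> (forall i, tangent_to_side V e i) <->
  [/\ exists t, tangent_at q (a, 0) (0, b) t,
      exists t, tangent_at q (0, b) (c, 0) t,
      exists t, tangent_at q (c, 0) (0, d) t &
      exists t, tangent_at q (0, d) (a, 0) t].
Proof.
move=> [_ _ _ [V0 V1 V2 V3]] eq.
have next (i j : 'I_4) z : val (i + 1) = val j -> V j = frame o u v z ->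
  V (i + 1) = frame o u v z by move=> /val_inj ->.
have T0 := tangent_to_sideE eq V0 (next 0 1 _ erefl V1).
have T1 := tangent_to_sideE eq V1 (next 1 2 _ erefl V2).
have T2 := tangent_to_sideE eq V2 (next 2 3 _ erefl V3).
have T3 := tangent_to_sideE eq V3 (next 3 0 _ erefl V0).
split=> [tV|[/T0 t0 /T1 t1 /T2 t2 /T3 t3]]; last exact: ord4P.
by split; [exact/T0|exact/T1|exact/T2|exact/T3].
Qed.

(** The four tangencies put the ellipse in the pencil, and the position of
    the point of contact on one side bounds the parameter. *)
Lemma inscribed_newton o u v a b c d e q : diagonal_frame o u v a b c d ->
  in_frame e o u v q -> inscribed V e ->
  exists2 k, 0 < k < 1 & q = newton_conic a c b d k.
Proof.
move=> fV eq [_ /(tangent_to_sidesE fV eq)[[t0 T0] [t1 T1] [t2 T2] [t3 T3]]].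
have [_ ac bd _] := fV; have q0 : posdef q by case: eq.
have tt z0 z1 t : tangent_at q z0 z1 t -> touches q z0 z1.
  by case=> _ A B; exact: (tangent_touches q0 A B).
have [k qE] := touches_newton_conic ac bd q0 (tt _ _ _ T0) (tt _ _ _ T1)
  (tt _ _ _ T2) (tt _ _ _ T3).
exists k => //; rewrite qE in q0 T0.
exact: (tangent_newton_range ac bd q0 T0).
Qed.

Lemma tangent_at_sym q z0 z1 t : tangent_at q z0 z1 t -> tangent_at q z1 z0 (1 - t).
Proof.
move=> [/andP[t0 t1]]; set w := _ + _ => qw pw.
rewrite /tangent_at (_ : _ + _ = w); last by rewrite subKr addrC.
rewrite qw -[z0 - z1]opprB; split=> //; first by apply/andP; split; lra.
by rewrite -[- (z1 - z0)]scaleN1r polarZ pw mulr0.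
Qed.

(** By [newton_support] the elliptic disk is in the four half-planes bounded
    by the sides, the intersection of which is the quadrilateral. *)
Lemma newton_inscribed o u v a b c d e k : diagonal_frame o u v a b c d ->
  0 < k < 1 -> in_frame e o u v (newton_conic a c b d k) -> inscribed V e.
Proof.
move=> fV k01 eq; have [J /andP[a0 c0] /andP[b0 d0] _] := fV.
have ac : a * c < 0 by rewrite nmulr_rlt0.
have bd : b * d < 0 by rewrite nmulr_rlt0.
have ca : c * a < 0 by rewrite mulrC.
have db : d * b < 0 by rewrite mulrC.
split.
  move=> p; rewrite /ellipse_curve /= -(frame_coordK o J p); have [_ -> _] := eq.
  move: (frame_coord o u v p) => z pe.
  have {}pe : conic_form (newton_conic a c b d k) z <= 1 by rewrite pe.
  apply: (region_frame fV).
  - exact: newton_support ac bd k01 pe.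
  - by rewrite newton_conicCl in pe; exact: newton_support ca bd k01 pe.
  - by rewrite newton_conicCr in pe; exact: newton_support ac db k01 pe.
  - by rewrite newton_conicCl newton_conicCr in pe; exact: newton_support ca db k01 pe.
apply/(tangent_to_sidesE fV eq); split.
- exact: tangent_newton.
- rewrite newton_conicCl.
  by have [t /tangent_at_sym] := tangent_newton ca bd k01; exists (1 - t).
- by rewrite newton_conicCl newton_conicCr; exact: tangent_newton.
- rewrite newton_conicCr.
  by have [t /tangent_at_sym] := tangent_newton ac db k01; exists (1 - t).
Qed.

End Quadrilaterals.

(** * The area of an elliptic disk *)

Section Area.
Context (R : realType).
Implicit Types (e : ellipse R) (q : conic R).
Local Notation mu := (@lebesgue_measure R).

Lemma lebesgue_measure_sqr_le (n h : R) :
  mu [set y | (y - n) ^+ 2 <= h] = (2 * Num.sqrt h)%:E.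
Proof.
have [h0|h0] := ltP h 0.
  rewrite ltr0_sqrtr// mulr0 (_ : [set _ | _] = set0) ?measure0//.
  apply/seteqP; split=> // y /= yh.
  by have := le_lt_trans yh h0; rewrite ltNge sqr_ge0.
rewrite (_ : [set _ | _] = [set` `[n - Num.sqrt h, n + Num.sqrt h]]).
  rewrite lebesgue_measure_itv /= lte_fin.
  have := sqrtr_ge0 h; rewrite le_eqVlt => /predU1P[<-|s0].
    by rewrite subr0 addr0 ltxx mulr0.
  rewrite ifT; last by lra.
  by rewrite -EFinB; congr EFin; ring.
apply/seteqP; split=> y /=; rewrite in_itv /= -ler_distl.
  by rewrite -sqrtr_sqr ler_sqrt.
by rewrite -sqrtr_sqr ler_sqrt.
Qed.

Lemma integral_affine (G : R -> R) (c s : R) : 0 < s -> continuous G ->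
  (forall x, 0 <= G x) ->
  (\int[mu]_x (G ((x - c) / s))%:E = s%:E * \int[mu]_x (G x)%:E)%E.
Proof.
move=> s0 cG G0; have sn : s != 0 by rewrite gt_eqF.
pose F (x : R) := (x - c) / s.
have F'E : F^`()%classic = cst s^-1.
  apply/funext => x; rewrite /F derive1E deriveM// deriveD// derive_cst scaler0.
  by rewrite add0r derive_id derive_cst addr0 scaler1.
have cF : continuous F.
  by move=> x; apply: cvgM; [apply: cvgB; [exact: cvg_id|exact: cvg_cst]|exact: cvg_cst].
rewrite (@increasing_ge0_integration_by_substitutionT _ F G)//.
- rewrite F'E -ge0_integralZl_EFin ?ltW//.
  + apply: eq_integral => x _; rewrite -EFinM; congr EFin.
    have -> : ((G \o F) * cst s^-1) x = G (F x) / s by [].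
    by rewrite /F; field.
  + by move=> x _; rewrite lee_fin mulr_ge0//= ?invr_ge0 ?ltW.
  + apply/measurable_EFinP/measurable_funM => //.
    apply: continuous_measurable_fun => x; apply: continuous_comp; first exact: cF.
    exact: cG.
- by move=> x y xy; rewrite /F ltr_pM2r ?invr_gt0// ltrD2r.
- by rewrite F'E => ?; exact: cvg_cst.
- by rewrite F'E; exact: is_cvg_cst.
- by rewrite F'E; exact: is_cvg_cst.
- by apply/gt0_cvgMlNy; [rewrite invr_gt0|exact: cvg_addrr_Ny].
- by apply/gt0_cvgMly; [rewrite invr_gt0|exact: cvg_addrr].
Qed.

Definition half_circle (x : R) : R := Num.sqrt (1 - x ^+ 2).

Lemma continuous_half_circle : continuous half_circle.
Proof.
move=> x; apply: (@continuous_comp _ _ _ (fun x : R => 1 - x ^+ 2) Num.sqrt).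
  by apply: cvgB; [exact: cvg_cst|exact: exprn_continuous].
exact: sqrt_continuous.
Qed.

(** The function is at least [1 / 2] between [- 1 / 2] and [1 / 2], and it
    is bounded by the indicator of the interval from [-1] to [1]. *)
Lemma integral_half_circle : exists2 k : R, 0 < k &
  (\int[mu]_x (half_circle x)%:E = k%:E)%E.
Proof.
have mI (A : set R) : measurable A -> measurable_fun setT (fun x => (\1_A x : R)%:E).
  by move=> mA; apply/measurable_EFinP.
have mG : measurable_fun setT (fun x => (half_circle x)%:E).
  apply/measurable_EFinP; apply: continuous_measurable_fun.
  exact: continuous_half_circle.
have le2 : (\int[mu]_x (half_circle x)%:E <= 2%:E)%E.
  apply: (@le_trans _ _ (\int[mu]_x (\1_`[-1, 1] x : R)%:E)%E).
    apply: ge0_le_integral => //.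
    - by move=> x _; rewrite lee_fin sqrtr_ge0.
    - exact: mI.
    move=> x _; rewrite lee_fin indicE.
    have [xI|] := boolP (x \in `[-1, 1]%classic).
      by rewrite -[leRHS]sqrtr1 ler_sqrt// lerBlDr lerDl sqr_ge0.
    rewrite notin_setE /= in_itv /= => /negP; rewrite -ler_norml -ltNge => x1.
    rewrite /half_circle ler0_sqrtr// subr_le0.
    have := real_normK (num_real x); nra.
  rewrite integral_indic// setIT /= lebesgue_measure_itv /= lte_fin.
  by rewrite ifT -?EFinB ?lee_fin; lra.
have gt0 : (0 < \int[mu]_x (half_circle x)%:E)%E.
  apply: (@lt_le_trans _ _ (\int[mu]_x ((1/2)%:E * (\1_`[- (1/2), 1/2] x : R)%:E))%E).
    rewrite ge0_integralZl_EFin//; last exact: mI.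
    rewrite integral_indic// setIT /= lebesgue_measure_itv /= lte_fin.
    by rewrite ifT -?EFinB -?EFinM ?lte_fin; lra.
  apply: ge0_le_integral => //.
  - by apply: measurable_funeM; exact: mI.
  move=> x _; rewrite -EFinM lee_fin indicE.
  have [|_] := boolP (x \in _); last by rewrite mulr0 sqrtr_ge0.
  rewrite inE /= in_itv /= => /andP[x1 x2]; rewrite mulr1.
  by rewrite -[leLHS]ger0_norm ?divr_ge0// -sqrtr_sqr ler_sqrt; nra.
have fin : (\int[mu]_x (half_circle x)%:E \is a fin_num)%E.
  by rewrite ge0_fin_numE ?ltW// (le_lt_trans le2)// ltry.
exists (fine (\int[mu]_x (half_circle x)%:E)%E); last by rewrite fineK.
by rewrite fine_gt0// gt0 (le_lt_trans le2)// ltry.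
Qed.

(** The vertical section of the elliptic disk at abscissa [x] is the
    interval of half-length [sqrt (det S / sxx)] times [half_circle] at the
    abscissa rescaled by [sqrt sxx], so that the area is [2 sqrt (det S)] times
    the integral of [half_circle]; and [det S] is the square of the product of
    the semi-axes. *)
Lemma area_semi_axes : exists2 k : R, 0 < k &
  forall e, area e = (k * (semi1 e * semi2 e))%:E.
Proof.
have [k k0 kE] := integral_half_circle.
exists (2 * k); first by rewrite mulr_gt0.
move=> e; have J : cross (1, 0) (0, 1) = 1 :> R by rewrite /cross /=; ring.
have [q [[S0 q0] eE dE]] : exists q, in_frame e 0 (1, 0) (0, 1) q.
  by apply: in_frame_exists; rewrite J oner_neq0.
rewrite J expr1n mulr1 in dE.
have frameE z : frame 0 (1, 0) (0, 1) z = z.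
  by rewrite (_ : 0 = (0, 0))//; case: z => x y; rewrite /frame !pairE /=; congr pair; ring.
have S1 := gt_eqF S0; have q1 := gt_eqF q0.
set S := sxx q in S0 S1; pose s := Num.sqrt S.
have s0 : 0 < s by rewrite sqrtr_gt0.
have s2 : s ^+ 2 = S by rewrite sqr_sqrtr// ltW.
have qE x y : conic_form q (x, y) = ((x - (conic_center q).1) / s) ^+ 2 + S / conic_det q *
    (y - ((conic_center q).2 + sxy q / S * (x - (conic_center q).1))) ^+ 2.
  rewrite expr_div_n s2 /conic_form /polar /S.
  move: S1 q1; rewrite /S /conic_det; case: (q) => [[m1 m2] A B C] /= A1 D1.
  by field; rewrite A1 D1.
have secE x : xsection (ellipse_disk e) x =
   [set y | (y - ((conic_center q).2 + sxy q / S * (x - (conic_center q).1))) ^+ 2 <=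
     conic_det q / S * (1 - ((x - (conic_center q).1) / s) ^+ 2)].
  have q1S : 0 < conic_det q / S by rewrite divr_gt0.
  have shift A B : (S / conic_det q * A <= B) = (A <= conic_det q / S * B).
    rewrite -(ler_pM2l q1S) mulrA (_ : conic_det q / S * (S / conic_det q) = 1) ?mul1r//.
    by field; rewrite S1 q1.
  apply/seteqP; split=> y; rewrite /xsection /= inE /ellipse_disk /=;
    by rewrite -{1}[(x, y)]frameE eE qE -lerBrDl shift.
rewrite /area /product_measure1.
transitivity (\int[mu]_x ((2 * Num.sqrt (conic_det q / S))%:E *
    (half_circle ((x - (conic_center q).1) / s))%:E))%E.
  apply: eq_integral => x _ /=.
  rewrite secE lebesgue_measure_sqr_le -EFinM.
  by rewrite (sqrtrM _ (ltW (divr_gt0 q0 S0))) mulrA.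
rewrite ge0_integralZl_EFin//; last first.
- apply/measurable_EFinP; apply: continuous_measurable_fun => x.
  apply: continuous_comp; last exact: continuous_half_circle.
  by apply: cvgM; [apply: cvgB; [exact: cvg_id|exact: cvg_cst]|exact: cvg_cst].
- by move=> x _; rewrite lee_fin sqrtr_ge0.
rewrite integral_affine//; last 2 first.
- exact: continuous_half_circle.
- by move=> x; rewrite sqrtr_ge0.
rewrite kE -!EFinM; congr EFin.
have -> : semi1 e * semi2 e = Num.sqrt (conic_det q).
  by rewrite dE sqrtr_sqr ger0_norm// mulr_ge0// ltW ?semi1_gt0 ?semi2_gt0.
rewrite sqrtrM ?ltW// sqrtrV ?ltW// -/s.
by field; rewrite gt_eqF.
Qed.

End Area.

(** * Extrema of the area along the pencil *)

Section Cubic.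
Context (R : realType).
Implicit Types (p r k s : R).

Definition area_cubic p r k := k * (1 - k) * ((1 - k) * p + k * r).

Lemma cubic_gt0 p r k : 0 < p -> 0 < r -> 0 < k < 1 -> 0 < area_cubic p r k.
Proof.
move=> p0 r0 /andP[k0 k1]; have k1' : 0 < 1 - k by lra.
by apply: mulr_gt0; [exact: mulr_gt0|apply: addr_gt0; exact: mulr_gt0].
Qed.

(** Strict logarithmic concavity, factor by factor: the square of an affine
    function at a midpoint exceeds the product of its values at the ends by the
    square of half their difference. *)
Lemma cubic_midpoint p r k s : 0 < p -> 0 < r -> 0 < k < 1 -> 0 < s < 1 ->
  k != s -> area_cubic p r k * area_cubic p r s < area_cubic p r ((k + s) / 2) ^+ 2.
Proof.
move=> p0 r0 /andP[k0 k1] /andP[s0 s1] ks.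
pose L x := (1 - x) * p + x * r.
pose m := (k + s) / 2; have m01 : 0 < m < 1 by apply/andP; split; rewrite /m; lra.
have L0 x : 0 < x -> x < 1 -> 0 < L x.
  move=> x0 x1; have x1' : 0 < 1 - x by lra.
  by apply: addr_gt0; exact: mulr_gt0.
have -> : area_cubic p r k * area_cubic p r s =
    (k * s) * ((1 - k) * (1 - s)) * (L k * L s) by rewrite /area_cubic /L; ring.
have -> : area_cubic p r ((k + s) / 2) ^+ 2 = m ^+ 2 * (1 - m) ^+ 2 * L m ^+ 2.
  by rewrite /area_cubic /L /m; ring.
have d0 : 0 < ((k - s) / 2) ^+ 2.
  by rewrite exprn_even_gt0//= mulf_neq0 ?subr_eq0// invr_neq0.
have e1 : k * s < m ^+ 2.
  by rewrite -subr_gt0 (_ : _ - _ = ((k - s) / 2) ^+ 2)// /m; field.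
have e2 : (1 - k) * (1 - s) < (1 - m) ^+ 2.
  by rewrite -subr_gt0 (_ : _ - _ = ((k - s) / 2) ^+ 2)// /m; field.
have e3 : L k * L s <= L m ^+ 2.
  rewrite -subr_ge0 (_ : _ - _ = ((L k - L s) / 2) ^+ 2) ?sqr_ge0//.
  by rewrite /L /m; field.
have ks0 : 0 < k * s by exact: mulr_gt0.
have ks1 : 0 < (1 - k) * (1 - s) by apply: mulr_gt0; lra.
have Lks : 0 < L k * L s by rewrite mulr_gt0// L0.
apply: (@lt_le_trans _ _ (m ^+ 2 * (1 - m) ^+ 2 * (L k * L s))).
  by rewrite ltr_pM2r// ltr_pM// ltW.
by rewrite ler_pM2l// mulr_gt0//; [exact: lt_trans e1|exact: lt_trans e2].
Qed.

(** The maximum over the closed interval is not at an end, where the cubic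
    vanishes, and two maxima would be beaten at their midpoint. *)
Lemma cubic_unique_max p r : 0 < p -> 0 < r -> exists2 k, 0 < k < 1 &
  forall s, 0 < s < 1 -> area_cubic p r s <= area_cubic p r k
                         /\ (area_cubic p r s = area_cubic p r k -> s = k).
Proof.
move=> p0 r0.
have cf : {within `[0, 1], continuous (area_cubic p r)}.
  apply: continuous_subspaceT => x; rewrite /area_cubic.
  have cid : (fun k : R => k) @ x --> x by exact: cvg_id.
  have c1 : (fun k : R => 1 - k) @ x --> 1 - x by apply: cvgB; [exact: cvg_cst|].
  apply: cvgM; first exact: cvgM.
  by apply: cvgD; apply: cvgM => //; exact: cvg_cst.
have [k kI kmax] := EVT_max ler01 cf.
have fle s : 0 < s < 1 -> area_cubic p r s <= area_cubic p r k.
  by move=> /andP[s0 s1]; apply: kmax; rewrite in_itv /= !ltW.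
have k01 : 0 < k < 1.
  have h01 : 0 < (1 / 2 : R) < 1 by lra.
  have f0 := lt_le_trans (cubic_gt0 p0 r0 h01) (fle _ h01).
  move: kI; rewrite in_itv /= => /andP[k0 k1].
  rewrite !lt_neqAle k0 k1 !andbT.
  by apply/andP; split; [apply: contraTneq f0 => <-|apply: contraTneq f0 => ->];
    rewrite /area_cubic ?subrr !(mul0r, mulr0) ltxx.
exists k => // s s01; split=> [|fsk]; first exact: fle.
apply: contraPeq (cubic_midpoint p0 r0 s01 k01) => sk /(_ sk).
have m01 : 0 < (s + k) / 2 < 1 by apply/andP; split; lra.
rewrite fsk -expr2 ltr_pXn2r ?nnegrE// ?(ltW (cubic_gt0 _ _ _))//.
by move/lt_geF; rewrite fle.
Qed.

(** The cubic tends to zero with [k]: it is less than [s * (p + r)] at [s],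
    and [s] is taken small enough in proportion to the value to be undercut. *)
Lemma cubic_no_min p r k : 0 < p -> 0 < r -> 0 < k < 1 ->
  exists2 s, 0 < s < 1 & area_cubic p r s < area_cubic p r k.
Proof.
move=> p0 r0 k01; have f0 := cubic_gt0 p0 r0 k01.
set f := area_cubic p r k in f0 *.
pose s := f / (f + p + r); have D0 : 0 < f + p + r by lra.
have s01 : 0 < s < 1.
  by rewrite /s divr_gt0//= ltr_pdivrMr// mul1r; lra.
exists s => //; case/andP: s01 => s0 s1.
have sE : s * (f + p + r) = f by rewrite divfK ?gt_eqF.
rewrite -sE /area_cubic -mulrA ltr_pM2l//; nra.
Qed.

End Cubic.

(** * The inscribed ellipses of extremal area *)

Section Comparison.
Context (R : realType).
Implicit Types (e : ellipse R) (o u v : R * R) (q : conic R).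

Lemma same_conic_same_curve e e' o u v q : cross u v != 0 ->
  in_frame e o u v q -> in_frame e' o u v q -> ellipse_curve e = ellipse_curve e'.
Proof.
move=> J [_ eE _] [_ eE' _]; apply/funext => p.
by rewrite /ellipse_curve /= -(frame_coordK o J p) eE eE'.
Qed.

Lemma area_le_det e e' o u v q q' : cross u v != 0 ->
  in_frame e o u v q -> in_frame e' o u v q' ->
  (area e <= area e')%E = (conic_det q <= conic_det q').
Proof.
move=> J [_ _ qE] [_ _ q'E]; have [k k0 aE] := area_semi_axes R.
rewrite !aE lee_fin ler_pM2l//.
have J2 : 0 < cross u v ^+ 2 by rewrite exprn_even_gt0.
rewrite -[RHS](ler_pM2r J2) qE q'E ler_pXn2r// nnegrE ltW// mulr_gt0//;
  by rewrite ?semi1_gt0 ?semi2_gt0.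
Qed.

End Comparison.

Theorem theorem7 (R : realType) (V : 'I_4 -> R * R)
    (hV : convex_quadrilateral V) :
  (exists! E : set (R * R),
     exists e : ellipse R, maximal_area_inscribed V e /\ E = ellipse_curve e)
  /\ ~ (exists e : ellipse R, minimal_area_inscribed V e).
Proof.
have [w [u [v [a [b [c [d fV]]]]]]] := convex_diagonal_frame hV.
have [J acs bds _] := fV.
have [/andP[a0 c0] /andP[b0 d0]] := (acs, bds).
have ac : a * c < 0 by rewrite nmulr_rlt0.
have bd : b * d < 0 by rewrite nmulr_rlt0.
pose p := - (a * c) * ((d - b) / 2) ^+ 2.
pose r := - (b * d) * ((c - a) / 2) ^+ 2.
have p0 : 0 < p.
  by apply: mulr_gt0; rewrite ?oppr_gt0// exprn_gt0// divr_gt0//; lra.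
have r0 : 0 < r.
  by apply: mulr_gt0; rewrite ?oppr_gt0// exprn_gt0// divr_gt0//; lra.
pose Q := newton_conic a c b d.
have detE k : conic_det (Q k) = area_cubic p r k by rewrite det_newton.
have inscribedP e : inscribed V e ->
    exists2 k, 0 < k < 1 & in_frame e w u v (Q k).
  have [q eq] := in_frame_exists e w J.
  by move=> /(inscribed_newton fV eq)[k k01 qE]; exists k; rewrite // /Q -qE.
have inscribed_ex k : 0 < k < 1 ->
    exists2 e, inscribed V e & in_frame e w u v (Q k).
  move=> k01; have [e eQ] := in_frame_realizable w J (posdef_newton ac bd k01).
  by exists e => //; exact: (newton_inscribed fV k01 eQ).
split; last first.
  move=> [e [Ve emin]]; have [k k01 eQ] := inscribedP e Ve.
  have [s s01 fsk] := cubic_no_min p0 r0 k01.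
  have [e' Ve' eQ'] := inscribed_ex s s01.
  by have := emin e' Ve'; rewrite (area_le_det J eQ eQ') !detE leNgt fsk.
have [k k01 kmax] := cubic_unique_max p0 r0.
have [e Ve eQ] := inscribed_ex k k01.
have emax : maximal_area_inscribed V e.
  split=> // e' /inscribedP[s s01 eQ'].
  by rewrite (area_le_det J eQ' eQ) !detE; have [] := kmax s s01.
exists (ellipse_curve e); split; first by exists e.
move=> E [e' [[Ve' emax'] ->]]; have [s s01 eQ'] := inscribedP e' Ve'.
have [fsk sk] := kmax s s01.
have := emax' e Ve; rewrite (area_le_det J eQ eQ') !detE => fks.
rewrite sk in eQ'; first exact: same_conic_same_curve J eQ eQ'.
by apply/eqP; rewrite eq_le fsk.
Qed.
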